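(* Let $K$ be a number field, $S$ a finite set of primes of $K$, and $L/K$ a Galois extension, unramified outside $S^{(2)}$, with $\operatorname{Gal}(L/K)=\langle\sigma,\tau\rangle\simeq S_3$, where $\sigma^3=\tau^2=1$. Let $L^\sigma$ and $L^\tau$ be the fixed fields of $\langle\sigma\rangle$ and $\langle\tau\rangle$. For $\lambda\in L\setminus\{0,1\}$ write $\mu=1-\lambda$ and consider the conditions (i) $\lambda\in\mathcal O^*_{L,L^\tau,S_L,1}$; (ii) $-\lambda\in\mathcal O^*_{L,L^\sigma,S_L,1}$; (iii) $\sigma(\lambda)=\frac1\mu$. (1) Let $E$ be an elliptic curve over $K$ with good reduction outside $S$, with $j$-invariant different from $0$ and $1728$, and whose $2$-division field is $L$; let $\Lambda\subset\mathcal O^*_{L,S_L}$ be the set of values of the $\lambda$-invariant of $E$. Then there exists $\lambda\in\Lambda$ satisfying (i), (ii) and (iii). (2) Conversely, let $\lambda\in\mathcal O^*_{L,S_L}$, put $\mu=1-\lambda$, $j=2^8\frac{(\lambda^2-\lambda+1)^3}{\lambda^2(1-\lambda)^2}$ and $w=j^2(j-1728)^3$, and assume $j\neq 0,1728$. If $\mu\in\mathcal O^*_{L,S_L}$ and (i), (ii), (iii) hold, then $j\in\mathcal O_{K,S}$. Moreover, if $w\in K(S,6)_{12}$, then $j$ is the $j$-invariant of an elliptic curve over $K$ with good reduction outside $S^{(6)}$.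
   Context: Primes are non-archimedean. For $n\ge 1$, $S^{(n)}=S\cup\{\mathfrak p:\operatorname{ord}_{\mathfrak p}(n)>0\}$. $\mathcal O_{K,S}$ is the ring of $S$-integers of $K$ (elements with $\operatorname{ord}_{\mathfrak p}\ge 0$ for all primes $\mathfrak p\notin S$ of $K$). $S_L$ is the set of primes of $L$ lying above primes in $S^{(2)}$. $\mathcal O^*_{L,S_L}$ is the group of $S_L$-units: $x\in L^*$ with $\operatorname{ord}_{\mathfrak B}(x)=0$ for all primes $\mathfrak B\notin S_L$ of $L$. For an intermediate field $K\subset M\subset L$, $\mathcal O^*_{L,M,S_L,1}=\{x\in\mathcal O^*_{L,S_L}:\operatorname{Norm}_{L/M}(x)=1\}$. $K(S,n)=\{x\in K^*/K^{*n}:\operatorname{ord}_{\mathfrak p}(x)\equiv 0 \bmod n\ \ \forall \mathfrak p\notin S\}$, and for $n\mid m$, $K(S,n)_m$ is the image of the natural map $K(S,m)\to K(S,n)$; ''$w\in K(S,6)_{12}$'' means that the class of $w\in K^*$ in $K^*/K^{*6}$ lies there. For an elliptic curve $E:y^2+a_1xy+a_3y=x^3+a_2x^2+a_4x+a_6$ over $K$, let $e_1,e_2,e_3$ be the roots of the $2$-division polynomial $f_2=4x^3+b_2x^2+2b_4x+b_6$, where $b_2=a_1^2+4a_2$, $b_4=2a_4+a_1a_3$, $b_6=a_3^2+4a_6$. The $2$-division field of $E$ is $K(e_1,e_2,e_3)$. The $\lambda$-invariant is $\lambda=\frac{e_1-e_3}{e_1-e_2}$; it depends on the ordering of the roots,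 and its possible values form the set $\Lambda=\{\lambda,1-\lambda,\frac1\lambda,\frac1{1-\lambda},1-\frac1\lambda,\frac{\lambda}{\lambda-1}\}$.
   Formalization: In part (2), the conclusion that j is an S-integer of K is replaced by j being an S^(2)-integer of K, since the printed claim fails when S omits a prime above 2 (e.g. K = Q, S = {13}, E: y^2+xy+y = x^3-x^2-3x+3, where ord_2(j) = -7). *)

(* Defs.v *)
From HB Require Import structures.
From mathcomp Require Import all_boot all_order all_algebra.
From mathcomp Require Import all_fingroup all_solvable all_field.
From mathcomp Require Import boolp classical_sets functions cardinality.

Set Implicit Arguments.
Unset Strict Implicit.
Unset Printing Implicit Defensive.

Import Order.TTheory GRing.Theory Num.Theory.
Local Open Scope ring_scope.

(* A prime is a non-archimedean place, represented by its normalized discrete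
   valuation; for a number field these are exactly the valuations attached to
   the nonzero prime ideals of the ring of integers.  The value at 0 (+oo in
   the literature) is set to 0, so that each place has a single representative
   and [0 <= ord p x] holds at x = 0, as it should. *)
Record prime_of (K : fieldType) := PrimeOf {
  ord : K -> int;
  ord0 : ord 0 = 0;
  ordM : forall x y, x != 0 -> y != 0 -> ord (x * y) = ord x + ord y;
  ordD : forall x y, x != 0 -> y != 0 -> x + y != 0 ->
    Num.min (ord x) (ord y) <= ord (x + y);
  ord_normalized : exists x, ord x = 1
}.

Section SUnits.
Variable K : fieldType.
Implicit Types (S : set (prime_of K)) (x : K) (n m : nat).

(* S^(n) *)
Definition primes_ext S n : set (prime_of K) :=
  (S `|` [set p | (0 < ord p n%:R)%R])%classic.

Definition S_integers S : set K :=
  [set x | forall p, ~ S p -> (0 <= ord p x)%R]%classic.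

Definition S_units S : set K :=
  [set x | x != 0 /\ forall p, ~ S p -> ord p x = 0]%classic.

(* Subsets of K^*/K^*n are described by representatives in K^*:
   [selmer S n x] says that the class of x lies in K(S,n), and
   [selmer_im S n m x] that the class of x modulo n-th powers lies in K(S,n)_m,
   i.e. is the image of the class modulo m-th powers of some z in K(S,m). *)
Definition selmer S n : set K :=
  [set x | x != 0 /\ forall p, ~ S p -> (n%:Z %| ord p x)%Z]%classic.

Definition selmer_im S n m : set K :=
  [set x | exists2 z, selmer S m z & exists2 y, y != 0 & x = z * y ^+ n]%classic.

End SUnits.

Section Extension.
Variables (K : fieldType) (L : splittingFieldType K).
Implicit Types (S : set (prime_of K)) (T : set (prime_of L)).

(* B lies above p with ramification index e *)
Definition ramification (B : prime_of L) (p : prime_of K) (e : nat) : Prop :=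
  (0 < e)%N /\ forall x : K, ord B x%:A = ord p x *+ e.

Definition lies_above (B : prime_of L) (p : prime_of K) : Prop :=
  exists e, ramification B p e.

(* Residue fields of number fields are finite, hence perfect, so that being
   unramified amounts to all the ramification indices being 1. *)
Definition unramified_outside S : Prop :=
  forall p, ~ S p -> forall B e, ramification B p e -> e = 1%N.

Definition primes_above S : set (prime_of L) :=
  [set B | exists2 p, S p & lies_above B p]%classic.

Definition S_units_norm1 (M : {subfield L}) T : set L :=
  [set x | S_units T x /\ galNorm M {:L} x = 1]%classic.

End Extension.

Arguments unramified_outside {K} L S.
Arguments primes_above {K} L S.

Record weierstrass (K : Type) := Weierstrass { a1 : K; a2 : K; a3 : K; a4 : K; a6 : K }.

Section Weierstrass.
Variable K : fieldType.
Implicit Type E : weierstrass K.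

Definition b2 E := a1 E ^+ 2 + 4 * a2 E.
Definition b4 E := 2 * a4 E + a1 E * a3 E.
Definition b6 E := a3 E ^+ 2 + 4 * a6 E.
Definition b8 E :=
  a1 E ^+ 2 * a6 E + 4 * a2 E * a6 E - a1 E * a3 E * a4 E + a2 E * a3 E ^+ 2
  - a4 E ^+ 2.
Definition c4 E := b2 E ^+ 2 - 24 * b4 E.
Definition disc E :=
  - b2 E ^+ 2 * b8 E - 8 * b4 E ^+ 3 - 27 * b6 E ^+ 2 + 9 * b2 E * b4 E * b6 E.
Definition jinv E := c4 E ^+ 3 / disc E.

Definition two_division_poly E : {poly K} :=
  4 *: 'X^3 + b2 E *: 'X^2 + (2 * b4 E) *: 'X + (b6 E)%:P.

(* The equation obtained from E by the substitution
   x = u^2 x' + r,  y = u^3 y' + u^2 s x' + t. *)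
Definition change_coord (u r s t : K) E : weierstrass K := {|
  a1 := (a1 E + 2 * s) / u;
  a2 := (a2 E - s * a1 E + 3 * r - s ^+ 2) / u ^+ 2;
  a3 := (a3 E + r * a1 E + 2 * t) / u ^+ 3;
  a4 := (a4 E - s * a3 E + 2 * r * a2 E - (t + r * s) * a1 E
         + 3 * r ^+ 2 - 2 * s * t) / u ^+ 4;
  a6 := (a6 E + r * a4 E + r ^+ 2 * a2 E + r ^+ 3 - t * a3 E - t ^+ 2
         - r * t * a1 E) / u ^+ 6
|}.

Definition integral_at (p : prime_of K) E : Prop :=
  [/\ 0 <= ord p (a1 E), 0 <= ord p (a2 E), 0 <= ord p (a3 E),
      0 <= ord p (a4 E) & 0 <= ord p (a6 E)].

(* [disc E != 0] is assumed wherever this is used, so that [ord p _ = 0] below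
   does say that the discriminant is a p-adic unit: the reduction modulo p of
   the new equation is nonsingular. *)
Definition good_reduction (p : prime_of K) E : Prop :=
  exists u r s t, [/\ u != 0, integral_at p (change_coord u r s t E)
    & ord p (disc (change_coord u r s t E)) = 0].

End Weierstrass.

Record elliptic_curve (K : fieldType) := EllipticCurve {
  ec_eq :> weierstrass K;
  ec_disc : disc ec_eq != 0
}.

Definition good_reduction_outside (K : fieldType) (S : set (prime_of K))
    (E : elliptic_curve K) : Prop :=
  forall p, ~ S p -> good_reduction p E.

Section TwoDivision.
Variables (K : fieldType) (L : splittingFieldType K).
Implicit Types (E : weierstrass K) (l : L).

Definition two_division_roots E (e1 e2 e3 : L) : Prop :=
  map_poly (in_alg L) (two_division_poly E)
  = 4 *: (('X - e1%:P) * ('X - e2%:P) * ('X - e3%:P)).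

Definition is_two_division_field E : Prop :=
  exists e1 e2 e3 : L, two_division_roots E e1 e2 e3
    /\ <<1 & [:: e1; e2; e3]>>%VS = {:L}%VS.

(* The values of the lambda-invariant for all the orderings of the roots. *)
Definition lambda_values E : set L :=
  [set l | exists e1 e2 e3 : L, two_division_roots E e1 e2 e3
    /\ l = (e1 - e3) / (e1 - e2)]%classic.

Definition j_of_lambda l : L :=
  2 ^+ 8 * ((l ^+ 2 - l + 1) ^+ 3 / (l ^+ 2 * (1 - l) ^+ 2)).

(* These conditions do not make j_of_lambda l integral at the primes of K above 2
   outside S: for K = Q, S = {13}, they hold for a lambda-invariant of the curve
   y^2 + xy + y = x^3 - x^2 - 3x + 3, of discriminant -2^7 * 13 and j-invariant
   -129^3 / (2^7 * 13).  Integrality of j is thus to be stated outside S^(2). *)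
Definition lambda_conditions (S : set (prime_of K)) (sigma tau : gal_of {:L}) l
    : Prop :=
  let SL := primes_above L (primes_ext S 2) in
  [/\ S_units_norm1 [aspace of fixedField <[tau]>%g] SL l,
      S_units_norm1 [aspace of fixedField <[sigma]>%g] SL (- l)
    & sigma l = (1 - l)^-1].

End TwoDivision.

Arguments is_two_division_field {K} L E.
Arguments lambda_values {K} L E.

(* Main.v *)
Require Import Defs.
From HB Require Import structures.
From mathcomp Require Import all_boot all_order all_algebra.
From mathcomp Require Import all_fingroup all_solvable all_field.
From mathcomp Require Import boolp classical_sets functions cardinality.
From mathcomp Require Import ring zify.
Set Implicit Arguments.
Unset Strict Implicit.
Unset Printing Implicit Defensive.
Import Order.TTheory GRing.Theory Num.Theory.
Local Open Scope ring_scope.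

(** Part (1).  A prime [B] of [L] outside [S_L] restricts, up to a positive
    factor, to a prime [p] of [K] outside [S^(2)] ([restrict_prime]).  In a
    model of [E] with good reduction at [p], the roots of the 2-division
    polynomial are [B]-integral, since [B] does not divide [4], and the
    discriminant, a [B]-unit, is [16] times the product of the squares of their
    differences; so each difference is a [B]-unit.  As [lambda] is a quotient of
    differences, unchanged by a change of coordinates, it is a [B]-unit
    ([lambda_S_unit]).  The Galois group permutes the three roots faithfully,
    [sigma] as a 3-cycle and [tau] as a transposition.  If [a] is the root fixed
    by [tau], [b = sigma a] and [c = sigma b] ([good_lambda]), then (i), (ii) and
    (iii) for [(a - c) / (a - b)] are identities between rational functions.

    Part (2).  By (iii) and (i), [sigma] maps [lambda] to [1 / (1 - lambda)] and
    [tau] maps it to [1 / lambda]; as [j] is invariant under both substitutions, it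
    lies in [K].  At a prime [p] of [K] outside [S^(2)], its
    integrality is read off at a prime [B] of [L] above [p], where [lambda] and
    [1 - lambda] are units.  That such a [B] exists ([extend_prime]) is the main
    work: by Zorn's lemma the ring of [p] lies in a valuation ring of [L] in which
    the uniformizer of [p] is not invertible ([exists_valuation_ring]), and since
    every element of [L] is algebraic over [K], a fixed power of it is a power of
    the uniformizer times a unit, which makes the valuation discrete.

    Finally ([curve_of_j]) the curve
    [y^2 = x^3 - 3 u^2 j (j - 1728) x - 2 u^3 j (j - 1728)^2] has invariant [j]
    and discriminant [2^12 3^6 u^6 w].  When [w = z y^6] with [z] in [K(S,12)],
    the choice [u = 1/(3 y)] makes the discriminant [2^12 z], whose valuation is a
    multiple of [12] outside [S]; at a prime not dividing [6] where [j] is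
    integral, rescaling then gives an integral model with unit discriminant. *)

(** * Valuation rings *)

(** The ring lemmas on membership apply to bundled subrings, while the subrings
    built below come as bare predicates. *)
Definition subring_pack (L : fieldType) (V : {pred L}) (closedV : subring_closed V)
    : subringClosed L :=
  HB.pack V (GRing.isSubringClosed.Build L V closedV).

Definition valuation_ring (L : fieldType) (V : subringClosed L) : Prop :=
  forall x, (x \in V) || (x^-1 \in V).

Section Integral.
Variables (L : fieldType) (V : subringClosed L) (valV : valuation_ring V).

(** A valuation ring is integrally closed: if [x] is not in [V] then [1/x] is, and
    dividing the integral equation by [x^(n-1)] writes [x] as a polynomial in
    [1/x]. *)
Lemma valuation_ring_integral x n (a : nat -> L) :
    (forall i, (i < n)%N -> a i \in V) -> x ^+ n = \sum_(i < n) a i * x ^+ i ->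
  x \in V.
Proof.
move=> Va Dxn; have /orP[//|Vx'] := valV x.
have [->|x0] := eqVneq x 0; first exact: rpred0.
case: n => [|n] in Va Dxn *.
  by move: Dxn; rewrite big_ord0 expr0 => /eqP; rewrite oner_eq0.
have -> : x = \sum_(i < n.+1) a i * x^-1 ^+ (n - i).
  apply: (mulIf (expf_neq0 n x0)); rewrite -exprS Dxn mulr_suml.
  apply: eq_bigr => i _; rewrite -mulrA; congr (_ * _).
  have le_in : (i <= n)%N by rewrite -ltnS.
  rewrite -[in X in _ * _ ^+ X](subnK le_in) exprD mulrA -exprMn mulVf //.
  by rewrite expr1n mul1r.
by apply: rpred_sum => i _; rewrite rpredM ?rpredX ?Va.
Qed.

(** [V]-divisibility is a total preorder, so a finite family has an element that
    divides all the others. *)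
Lemma valuation_ring_max (I : eqType) (s : seq I) (f : I -> L) :
    {in s, forall i, f i != 0} -> s != [::] ->
  exists2 m, m \in s & {in s, forall i, f i / f m \in V}.
Proof.
elim: s => // i0 s IHs nz _; have nz0 : f i0 != 0 by rewrite nz ?mem_head.
have nzs : {in s, forall i, f i != 0} by move=> i si; rewrite nz ?inE ?si ?orbT.
have [s0|sn0] := eqVneq s [::].
  exists i0; first exact: mem_head.
  by move=> i; rewrite s0 inE => /eqP->; rewrite divff ?rpred1.
have [m sm maxm] := IHs nzs sn0; have /orP[Vm|Vm] := valV (f i0 / f m).
  exists m => [|i]; first by rewrite inE sm orbT.
  by rewrite inE => /predU1P[->|/maxm].
exists i0; first exact: mem_head.
move=> i; rewrite inE => /predU1P[->|/maxm Vi]; first by rewrite divff ?rpred1.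
have -> : f i / f i0 = f i / f m * (f i0 / f m)^-1.
  by rewrite invf_div mulrA divfK ?nzs.
by rewrite rpredM.
Qed.

(** In a vanishing sum the least value is reached at least twice: dividing by a
    term [f m] of least value gives [1] plus a sum of terms of [V], which cannot
    vanish if all these terms are non-units. *)
Lemma valuation_ring_tie (I : eqType) (s : seq I) (f : I -> L) :
    uniq s -> s != [::] -> {in s, forall i, f i != 0} ->
    \sum_(i <- s) f i = 0 ->
  exists i j, [/\ i \in s, j \in s, i != j, f i / f j \in V & f j / f i \in V].
Proof.
move=> Us sn0 nz sum0; have [m sm maxm] := valuation_ring_max nz sn0.
apply: contrapT => noTie.
have nonunit i : i \in rem m s -> f m / f i \notin V.
  rewrite mem_rem_uniq // inE => /andP[nim si]; apply/negP => Vi; apply: noTie.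
  by exists m, i; split => //; [rewrite eq_sym | exact: maxm].
have subm i : i \in rem m s -> i \in s by apply: mem_rem.
have fm0 := nz m sm.
(* the sum is shown to be a non-unit, by induction: [0] or an element whose
   inverse is not in [V] *)
suff : \sum_(i <- rem m s) f i / f m = 0 \/
       ((\sum_(i <- rem m s) f i / f m)^-1 \notin V).
  have -> : \sum_(i <- rem m s) f i / f m = -1.
    move: sum0; rewrite (big_rem m) //= -mulr_suml => /eqP.
    by rewrite addrC addr_eq0 => /eqP->; rewrite mulNr divff.
  by case=> [/eqP|]; rewrite ?oppr_eq0 ?oner_eq0 // invrN1 rpredN rpred1.
elim: (rem m s) nonunit subm => [|i r IHr] nonunit subm; first by left; rewrite big_nil.
have sub_r j : j \in r -> j \in i :: r by rewrite inE => ->; rewrite orbT.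
have := IHr (fun j rj => nonunit j (sub_r j rj)) (fun j rj => subm j (sub_r j rj)).
have := nonunit i (mem_head i r); have := maxm i (subm i (mem_head i r)).
have : f i != 0 by rewrite nz ?subm ?mem_head.
rewrite big_cons; set y := \sum_(_ <- _) _; set x := f i / f m => fi0 Vx Vx'.
have x0 : x != 0 by rewrite mulf_neq0 ?invr_eq0.
have {}Vx' : x^-1 \notin V by rewrite invf_div.
have Vy : y \in V.
  rewrite /y big_seq_cond rpred_sum // => j; rewrite andbT => rj.
  by rewrite maxm ?subm ?inE ?rj ?orbT.
case=> [->|Vy']; first by right; rewrite addr0.
have [|z0] := eqVneq (x + y) 0; [by left | right].
have y0 : y != 0 by apply: contraNneq Vy' => ->; rewrite invr0 rpred0.
apply/negP => Vz.
have /orP[Vq|Vq] := valV (y / x).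
  case/negP: Vx'; have -> : x^-1 = (1 + y / x) * (x + y)^-1 by field; rewrite z0.
  by rewrite rpredM ?rpredD ?rpred1.
case/negP: Vy'; have -> : y^-1 = (1 + (y / x)^-1) * (x + y)^-1.
  by field; rewrite x0 z0 y0.
by rewrite rpredM ?rpredD ?rpred1.
Qed.

End Integral.

(** Chevalley's argument: a subring [V] that is maximal among those in which [t]
    is not invertible is a valuation ring. *)
Section Chevalley.
Variables (L : fieldType) (V : subringClosed L) (t : L).
Hypotheses (Vt : t \in V) (Vt' : t^-1 \notin V).
Hypothesis maxV : forall W : subringClosed L, {subset V <= W} ->
  t^-1 \notin W -> {subset W <= V}.

Let t0 : t != 0.
Proof. by apply: contraNneq Vt' => ->; rewrite invr0 rpred0. Qed.

(* adjoining any element outside V makes t invertible *)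
Let adjoinV x : x \notin V -> exists2 p, p \is a polyOver V & p.[x] = t^-1.
Proof.
move=> Vx; pose W := [pred y | `[< exists2 p, p \is a polyOver V & p.[x] = y >]].
have closedW : subring_closed W.
  split=> [|_ _ /asboolP[p Vp <-] /asboolP[q Vq <-]
           |_ _ /asboolP[p Vp <-] /asboolP[q Vq <-]].
  - by apply/asboolP; exists 1; rewrite ?rpred1 ?hornerE.
  - by apply/asboolP; exists (p - q); rewrite ?rpredB ?hornerE.
  - by apply/asboolP; exists (p * q); rewrite ?rpredM ?hornerE.
have sVW : {subset V <= W}.
  by move=> y Vy; apply/asboolP; exists y%:P; rewrite ?polyOverC ?hornerE.
have [/asboolP//|Wt] := boolP (t^-1 \in W).
case/negP: Vx; apply: (maxV (W := subring_pack closedW) sVW Wt).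
by apply/asboolP; exists 'X; rewrite ?polyOverX ?hornerE.
Qed.

(* If the inverse of u = 1 - t c were outside V, then 1/t would be a polynomial in
   it.  A power of u clears the denominators and is 1 modulo t V, which would put
   1/t in V. *)
Let unitV c : c \in V -> 1 - t * c != 0 /\ (1 - t * c)^-1 \in V.
Proof.
move=> Vc; set u := 1 - t * c.
have Vu : u \in V by rewrite rpredB ?rpred1 ?rpredM.
have u0 : u != 0.
  apply: contra Vt'; rewrite subr_eq0 => /eqP tc1.
  by rewrite -[t^-1]mulr1 tc1 mulKf.
split=> //; have [//|/adjoinV[p Vp ptu]] := boolP (u^-1 \in V).
have Vup : u ^+ size p * t^-1 \in V.
  rewrite -ptu horner_coef mulr_sumr rpred_sum // => i _.
  rewrite mulrCA rpredM ?(polyOverP Vp) //.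
  rewrite -[X in u ^+ X * _](subnK (ltnW (ltn_ord i))) exprD.
  by rewrite -mulrA -exprMn divff // expr1n mulr1 rpredX.
have [d Vd Du] : exists2 d, d \in V & u ^+ size p = 1 - t * d.
  elim: (size p) => [|n [d Vd Dn]]; first by exists 0; rewrite ?rpred0 ?mulr0 ?subr0.
  exists (d + c * (1 - t * d)); last by rewrite exprS Dn /u; ring.
  by rewrite rpredD ?rpredM ?rpredB ?rpred1 ?rpredM.
case/negP: Vt'; have -> : t^-1 = u ^+ size p * t^-1 + d by rewrite Du; field.
by rewrite rpredD.
Qed.

(* If 1/t is a polynomial p in x and a polynomial q in 1/x, the shorter relation
   expresses the leading power of x in the longer one by lower powers; this is an
   infinite descent.  The equation for q can be solved for its constant term
   because 1 - t q_0 is invertible. *)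
Let no_pair n x (p q : {poly L}) : x != 0 -> (size p + size q <= n)%N ->
  p \is a polyOver V -> q \is a polyOver V -> p.[x] = t^-1 -> q.[x^-1] <> t^-1.
Proof.
elim: n x p q => [|n IHn] x p q x0.
  rewrite leqn0 addn_eq0 !size_poly_eq0 => /andP[/eqP-> _] _ _ /esym/eqP.
  by rewrite horner0 invr_eq0 (negPf t0).
wlog le_qp : x p q x0 / (size q <= size p)%N.
  move=> IH szpq Vp Vq px qx; have [le_qp|/ltnW le_pq] := leqP (size q) (size p).
    exact: (IH x p q).
  by apply: (IH x^-1 q p); rewrite ?invr_eq0 ?invrK 1?addnC.
move=> szpq Vp Vq px qx.
have [u0 Vu'] := unitV (polyOverP Vq 0); set u := 1 - _ in u0 Vu'.
have qn0 : q != 0.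
  by apply: contra_eq_neq qx => ->; rewrite horner0 eq_sym invr_eq0.
have [m Dm] : {m | size q = m.+1} by exists (size q).-1; rewrite prednK ?size_poly_gt0.
have [k Dk] : {k | size p = k.+1}.
  by exists (size p).-1; rewrite prednK // (leq_trans _ le_qp) ?Dm.
have le_mk : (m <= k)%N by rewrite -ltnS -Dm -Dk.
have Dxk : x ^+ k = \sum_(i < m) t * (q`_i.+1 / u) * x ^+ (k - i.+1).
  apply: (mulfI u0); rewrite mulr_sumr.
  have Du : u = t * (q.[x^-1] - q`_0) by rewrite qx mulrBr divff.
  rewrite {1}Du horner_coef Dm big_ord_recl /= expr0 mulr1 addrAC subrr add0r.
  rewrite mulr_sumr mulr_suml; apply: eq_bigr => i _; rewrite /bump /= add1n.
  have -> : x ^+ k = x ^+ (k - i.+1) * x ^+ i.+1.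
    by rewrite -exprD subnK // (leq_trans (ltn_ord i)).
  rewrite exprVn; field.
  by rewrite u0 expf_neq0.
pose p' := take_poly k p
   + \sum_(i < m) (p`_k * (t * (q`_i.+1 / u))) *: 'X^(k - i.+1).
have szp' : (size p' <= k)%N.
  rewrite (leq_trans (size_polyD _ _)) // geq_max size_take_poly /=.
  rewrite (leq_trans (size_sum _ _ _)) //; apply/bigmax_leqP => i _.
  rewrite (leq_trans (size_scale_leq _ _)) // size_polyXn.
  by have := ltn_ord i; lia.
apply: (IHn x p' q) => //.
- by move: szpq; rewrite Dk; lia.
- rewrite rpredD //.
    apply/polyOverP => i; rewrite coef_take_poly; case: ifP => _; rewrite ?rpred0 //.
    exact: (polyOverP Vp).
  apply: rpred_sum => i _; rewrite polyOverZ ?rpredX ?polyOverX //.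
  by rewrite !rpredM ?(polyOverP Vp) ?(polyOverP Vq).
rewrite -px /p' hornerD (horner_coef p) Dk big_ord_recr /=; congr (_ + _).
  rewrite (horner_coef_wide _ (size_take_poly k p)); apply: eq_bigr => i _.
  by rewrite coef_take_poly ltn_ord.
rewrite Dxk mulr_sumr horner_sum; apply: eq_bigr => i _.
by rewrite hornerZ hornerXn; ring.
Qed.

Lemma maximal_valuation_ring : valuation_ring V.
Proof.
move=> x; apply: contrapT => /negP/norP[Vx Vx'].
have x0 : x != 0 by apply: contraNneq Vx => ->; rewrite rpred0.
have [p Vp px] := adjoinV Vx; have [q Vq qx] := adjoinV Vx'.
exact: (no_pair x0 (leqnn _) Vp Vq px qx).
Qed.

End Chevalley.

(** Zorn's lemma yields a maximal subring among those that contain [R] and in which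
    [t] is not invertible. *)
Lemma exists_valuation_ring (L : fieldType) (R : {pred L}) (t : L) :
    subring_closed R -> t \in R -> t^-1 \notin R ->
  exists V : subringClosed L, [/\ valuation_ring V, {subset R <= V} & t^-1 \notin V].
Proof.
move=> closedR Rt Rt'.
(* the ring R is put in the union to make the empty chain harmless *)
pose J (A : set L) := [pred x | (x \in R) || `[< A x >]].
have inJ (A : set L) x : A x -> x \in J A.
  by move=> Ax; apply/orP; right; apply/asboolP.
pose P (A : set L) := subring_closed (J A) /\ t^-1 \notin J A.
have [F sFP totF|A [[closedA At'] maxA]] := Zorn_bigcup (P := P).
  set U := (\bigcup_(X in F) X)%classic.
  have sFU A : F A -> {subset J A <= J U}.
    move=> FA x /orP[Rx|/asboolP Ax]; first by rewrite inE Rx.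
    by apply: inJ; exists A.
  have P0 : P set0.
    have J0 : J set0 =i R by move=> z; rewrite inE asboolF ?orbF.
    split; last by rewrite J0.
    case: closedR => R1 RB RM.
    by split=> [|a b|a b]; rewrite !J0 //; [exact: RB | exact: RM].
  have UP x y : x \in J U -> y \in J U ->
    exists A, [/\ P A, x \in J A, y \in J A & {subset J A <= J U}].
  - case/orP=> [Rx|/asboolP[A FA Ax]]; case/orP=> [Ry|/asboolP[B FB By]].
    + exists set0; rewrite !inE Rx Ry; split=> // z /orP[Rz|/asboolP//].
      by rewrite inE Rz.
    + by exists B; split; [exact: sFP | rewrite inE Rx | exact: inJ | exact: sFU].
    + by exists A; split; [exact: sFP | exact: inJ | rewrite inE Ry | exact: sFU].
    + have [sAB|sBA] := totF A B FA FB.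
        by exists B; split; [exact: sFP | exact/inJ/sAB | exact: inJ | exact: sFU].
      by exists A; split; [exact: sFP | exact: inJ | exact/inJ/sBA | exact: sFU].
  split; last first.
    by apply/negP => Ut'; have [A [[_ /negP At'] At _ _]] := UP _ _ Ut' Ut'.
  split=> [|x y Ux Uy|x y Ux Uy].
  - by rewrite inE; case: closedR => ->.
  - by have [A [[[_ AB _] _] Ax Ay sAU]] := UP _ _ Ux Uy; apply/sAU/AB.
  - by have [A [[[_ _ AM] _] Ax Ay sAU]] := UP _ _ Ux Uy; apply/sAU/AM.
exists (subring_pack closedA).
have sRA : {subset R <= J A} by move=> x Rx; rewrite inE Rx.
split=> //; apply: (maximal_valuation_ring (t := t)) => //; first exact: sRA.
move=> W sAW Wt' x Wx; apply: contrapT => Ax.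
apply: (maxA [set` W]%classic).
  split; first by move=> y Ay; apply/sAW/inJ.
  by move=> /(_ x Wx)/inJ Jx; apply: Ax.
have eW : J [set` W]%classic =i W.
  by move=> z; rewrite inE /= asboolb; case: (boolP (z \in R)) => //= /sRA/sAW->.
split; last by rewrite eW.
by split=> [|a b|a b]; rewrite !eW; [exact: rpred1 | exact: rpredB | exact: rpredM].
Qed.

(** * Primes and their behaviour in extensions *)

Section Ord.
Variables (K : fieldType) (p : prime_of K).
Implicit Types x y : K.

Lemma ord1 : ord p 1 = 0.
Proof. by have := @ordM _ p 1 1; rewrite oner_eq0 mulr1 => /(_ isT isT); lia. Qed.

Lemma ordN1 : ord p (-1) = 0.
Proof.
have N1 : -1 != 0 :> K by rewrite oppr_eq0 oner_eq0.
by have := ordM p N1 N1; rewrite mulrNN mulr1 ord1; lia.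
Qed.

Lemma ordN x : ord p (- x) = ord p x.
Proof.
have [->|x0] := eqVneq x 0; first by rewrite oppr0.
by rewrite -mulN1r ordM ?oppr_eq0 ?oner_eq0 // ordN1 add0r.
Qed.

Lemma ordV x : ord p x^-1 = - ord p x.
Proof.
have [->|x0] := eqVneq x 0; first by rewrite invr0 Defs.ord0 oppr0.
by have := ordM p x0 (invr_neq0 x0); rewrite divff // ord1; lia.
Qed.

Lemma ordX x n : ord p (x ^+ n) = ord p x *+ n.
Proof.
have [->|x0] := eqVneq x 0.
  by rewrite Defs.ord0 mul0rn expr0n; case: n => [|n]; rewrite ?Defs.ord0 ?ord1.
by elim: n => [|n IHn]; rewrite ?ord1 // exprS ordM ?expf_neq0 // IHn mulrS.
Qed.

Lemma ordZ x (k : int) : x != 0 -> ord p (x ^ k) = ord p x * k.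
Proof.
case: k => n x0; first by rewrite -exprnP ordX -mulr_natr natz.
by rewrite NegzE -exprnN ordV ordX -mulr_natr natz mulrN.
Qed.

Definition ord_ring : {pred K} := [pred x | 0 <= ord p x].

Lemma ord_ringE x : (x \in ord_ring) = (0 <= ord p x). Proof. by []. Qed.

Lemma ord_ring_closed : subring_closed ord_ring.
Proof.
split=> [|x y|x y]; rewrite !inE ?ord1 //.
  have [->|x0] := eqVneq x 0; first by rewrite sub0r ordN.
  have [->|y0] := eqVneq y 0; first by rewrite subr0.
  have [->|xy0] := eqVneq (x - y) 0; first by rewrite Defs.ord0.
  move=> px py; apply: le_trans (ordD p x0 _ xy0); last by rewrite oppr_eq0.
  by rewrite le_min ordN px.
have [->|x0] := eqVneq x 0; first by rewrite mul0r Defs.ord0.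
have [->|y0] := eqVneq y 0; first by rewrite mulr0 Defs.ord0.
by rewrite ordM //; apply: addr_ge0.
Qed.

HB.instance Definition _ := GRing.isSubringClosed.Build K ord_ring ord_ring_closed.

Lemma ord_valuation_ring : valuation_ring ord_ring.
Proof. by move=> x; rewrite !inE ordV; lia. Qed.

End Ord.

(** The image of [w] is a nonzero subgroup of the integers; [w] is divided by its
    positive generator [g], the least positive value. *)
Lemma normalize_valuation (L : fieldType) (w : L -> int) :
    w 0 = 0 -> (forall x y, x != 0 -> y != 0 -> w (x * y) = w x + w y) ->
    (forall x y, x != 0 -> y != 0 -> x + y != 0 -> Num.min (w x) (w y) <= w (x + y)) ->
    (exists x, w x != 0) ->
  exists (B : prime_of L) (g : nat), (0 < g)%N /\ forall x, w x = ord B x *+ g.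
Proof.
move=> w0 wM wD [x wx].
have w1 : w 1 = 0 by have := wM 1 1; rewrite oner_eq0 mulr1 => /(_ isT isT); lia.
have nz y : w y != 0 -> y != 0 by apply: contra_neq => ->.
have wV y : y != 0 -> w y^-1 = - w y.
  by move=> y0; have := wM y _ y0 (invr_neq0 y0); rewrite divff // w1; lia.
have wX y n : y != 0 -> w (y ^+ n) = w y *+ n.
  by move=> y0; elim: n => // n IHn; rewrite exprS wM ?expf_neq0 // IHn mulrS.
have wZ y (k : int) : y != 0 -> w (y ^ k) = w y * k.
  case: k => n y0; first by rewrite -exprnP wX // -mulr_natr natz.
  by rewrite NegzE -exprnN wV ?expf_neq0 // wX // -mulr_natr natz mulrN.
have exg : exists n, `[< (0 < n)%N /\ exists y, w y = n >].
  exists `|w x|%N; apply/asboolP; split; first by lia.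
  have [le0|lt0] := leP 0 (w x); first by exists x; lia.
  by exists x^-1; rewrite wV ?nz //; lia.
case: (ex_minnP exg) => g /asboolP[g_gt0 [y wy]] ming.
have y0 : y != 0 by apply: nz; rewrite wy; lia.
have dvd_g z : (g %| w z)%Z.
  have [->|z0] := eqVneq z 0; first by rewrite w0.
  apply/dvdz_mod0P; have := modz_ge0 (w z) (_ : g%:Z != 0); rewrite -lt0n => /(_ g_gt0).
  have := ltz_pmod (w z) (_ : 0 < g%:Z) => /(_ g_gt0).
  set r := (w z %% g)%Z => ltrg ge0r; apply/eqP; rewrite -[_ == _]negbK; apply/negP => rn0.
  suff /ming : `[< (0 < `|r|)%N /\ exists y, w y = `|r|%N >] by lia.
  apply/asboolP; split; first by lia.
  exists (z * y ^ (- (w z %/ g)%Z)).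
  rewrite wM ?expfz_neq0 // wZ // wy gez0_abs // /r /modz; lia.
pose v z := (w z %/ g)%Z.
have wv z : w z = v z * g by rewrite divzK.
have v0 : v 0 = 0 by rewrite /v w0 div0z.
have vM z1 z2 : z1 != 0 -> z2 != 0 -> v (z1 * z2) = v z1 + v z2.
  by move=> z10 z20; have := wM _ _ z10 z20; rewrite !wv; nia.
have vD z1 z2 : z1 != 0 -> z2 != 0 -> z1 + z2 != 0 ->
    Num.min (v z1) (v z2) <= v (z1 + z2).
  by move=> z10 z20 z120; have := wD _ _ z10 z20 z120; rewrite !wv; nia.
have vy : exists z, v z = 1 by exists y; rewrite /v wy divzz -lt0n g_gt0.
exists (PrimeOf v0 vM vD vy), g; split=> // z.
by rewrite /= wv -mulr_natr natz.
Qed.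

Section Extension.
Variables (K : fieldType) (L : fieldExtType K).

(** A power relation whose degree is bounded independently of [x]; the
    coefficients come from the minimal polynomial. *)
Lemma algebraic_relation (x : L) : exists n, exists2 a : nat -> K, (n <= \dim {:L})%N
  & x ^+ n = \sum_(i < n) (a i)%:A * x ^+ i.
Proof.
pose n := adjoin_degree 1%AS x.
have [a Da] : exists a : nat -> K, forall i, (minPoly 1%AS x)`_i = - (a i)%:A.
  suff /choice[a Da] : forall i, exists c : K, (minPoly 1%AS x)`_i = - c%:A by exists a.
  move=> i; have /polyOverP/(_ i)/vlineP[c ->] := minPolyOver 1%AS x.
  by exists (- c); rewrite scaleNr opprK.
exists n, a; first by rewrite /n adjoin_degreeE dimv1 divn1 dimvS ?subvf.
have /eqP := minPolyxx 1%AS x; rewrite horner_coef size_minPoly big_ord_recr /=.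
have /monicP := monic_minPoly 1%AS x; rewrite lead_coefE size_minPoly /= => ->.
rewrite mul1r addrC addr_eq0 => /eqP->; rewrite -sumrN.
by apply: eq_bigr => i _; rewrite Da mulNr opprK.
Qed.

(** The restriction of [B] to [K] only needs to be normalized once it is known to
    be nontrivial. *)
Lemma restrict_prime (B : prime_of L) : exists p : prime_of K, exists e,
  (0 < e)%N /\ forall x : K, ord B x%:A = ord p x *+ e.
Proof.
have inj0 (x : K) : x != 0 -> x%:A != 0 :> L by rewrite scaler_eq0 oner_eq0 orbF.
have [||x y x0 y0 xy0||p [e [e0 De]]] :=
    normalize_valuation (w := fun x : K => ord B x%:A); last by exists p, e.
- by rewrite scale0r Defs.ord0.
- by move=> x y /inj0 x0 /inj0 y0; rewrite -ordM // -in_algE rmorphM.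
- by rewrite scalerDl; apply: ordD; rewrite ?inj0 // -scalerDl inj0.
(* if B is trivial on K, then all of L is integral over the ring of B *)
apply: contrapT => triv; have [y By] := ord_normalized B.
have [n [a _ Dyn]] := algebraic_relation y^-1.
suff : y^-1 \in ord_ring B by rewrite inE ordV By.
apply: (valuation_ring_integral (@ord_valuation_ring _ B)
  (a := fun i => (a i)%:A) _ Dyn) => i _.
have [Ba0|Ba] := eqVneq (ord B (a i)%:A) 0; last by case: triv; exists (a i).
by rewrite ord_ringE Ba0.
Qed.

(** Let [V] be a valuation ring of [L] over that of [p] in which the uniformizer
    [pi] is not invertible.  By [valuation_ring_tie], two terms of an algebraic
    relation for [x] over [K] differ by a unit of [V], so some power [x^n], with
    [n] at most the degree [d] of [L], is a power of [pi] times a unit.  For [N]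
    the factorial of [d], [w x] is then the exponent for which
    [x^N / pi^(w x)] is a unit; it is a valuation extending [N] times that of [p],
    and normalizing it yields [B]. *)
Lemma extend_prime (p : prime_of K) : exists B : prime_of L, exists e,
  (0 < e)%N /\ forall x : K, ord B x%:A = ord p x *+ e.
Proof.
have [pi ppi] := ord_normalized p.
have pi0 : pi != 0 by apply: contra_eq_neq ppi => ->; rewrite Defs.ord0.
have inj0 (x : K) : x != 0 -> x%:A != 0 :> L by rewrite scaler_eq0 oner_eq0 orbF.
pose R := [pred y : L | `[< exists2 x, x \in ord_ring p & y = x%:A >]].
have inR (x : K) : x \in ord_ring p -> x%:A \in R by move=> px; apply/asboolP; exists x.
have RE (x : K) : x%:A \in R -> x \in ord_ring p.
  case/asboolP => z pz /eqP; rewrite -subr_eq0 -scalerBl scaler_eq0 oner_eq0 orbF.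
  by rewrite subr_eq0 => /eqP->.
have closedR : subring_closed R.
  split=> [|_ _ /asboolP[x px ->] /asboolP[y py ->]
           |_ _ /asboolP[x px ->] /asboolP[y py ->]].
  - by rewrite -[1]scale1r inR ?rpred1.
  - by rewrite -scalerBl inR ?rpredB.
  - by rewrite -!in_algE -rmorphM inR ?rpredM.
have algV (x : K) : x%:A^-1 = x^-1%:A :> L by rewrite -!in_algE fmorphV.
have algX (x : K) n : x%:A ^+ n = (x ^+ n)%:A :> L by rewrite -!in_algE rmorphXn.
have algZ (x : K) (k : int) : x%:A ^ k = (x ^ k)%:A :> L.
  by case: k => n; rewrite ?NegzE -?exprnP -?exprnN ?algX ?algV.
have algM (x y : K) : (x * y)%:A = x%:A * y%:A :> L by rewrite -!in_algE rmorphM.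
have [||V [valV sRV Vpi]] := exists_valuation_ring (t := pi%:A) closedR.
- by rewrite inR // inE ppi.
- by apply/negP; rewrite algV => /RE; rewrite inE ordV ppi.
have VE (x : K) : (x%:A \in V) = (0 <= ord p x).
  apply/idP/idP => [Vx | px]; last by rewrite sRV ?inR.
  rewrite leNgt; apply/negP => ltx0; case/negP: Vpi.
  have x0 : x != 0 by apply: contraTneq ltx0 => ->; rewrite Defs.ord0.
  have -> : pi%:A^-1 = x%:A * (x * pi)^-1%:A :> L.
    by rewrite algV -algM invfM mulrA divff // mul1r.
  by rewrite rpredM // sRV ?inR // inE ordV ordM // ppi; lia.
have tie (x : L) : x != 0 -> exists n, exists k : int,
    [/\ (0 < n)%N, (n <= \dim {:L})%N,
        x ^+ n / pi%:A ^ k \in V & pi%:A ^ k / x ^+ n \in V].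
  move=> x0; have [n [a le_nd Dxn]] := algebraic_relation x.
  (* c and f are the coefficients and the terms of the relation, with x^n moved
     to the other side *)
  pose c i := if i == n then -1 else a i.
  pose f i := (c i)%:A * x ^+ i; pose s := [seq i <- iota 0 n.+1 | f i != 0].
  have nzf : {in s, forall i, f i != 0} by move=> i; rewrite mem_filter => /andP[].
  have sum0 : \sum_(i <- s) f i = 0.
    have -> : \sum_(i <- s) f i = \sum_(0 <= i < n.+1) f i.
      rewrite big_filter big_mkcond /= /index_iota subn0; apply: eq_bigr => i _.
      by case: (eqVneq (f i) 0) => [->|].
    rewrite big_nat_recr //= big_mkord {2}/f /c eqxx scaleN1r mulN1r Dxn.
    apply/eqP; rewrite subr_eq0; apply/eqP/eq_bigr => i _.
    by rewrite /f /c (ltn_eqF (ltn_ord i)).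
  have sn : n \in s.
    rewrite mem_filter mem_iota /= add0n ltnSn andbT /f /c eqxx.
    by rewrite scaleN1r mulN1r oppr_eq0 expf_neq0.
  have Us : uniq s by rewrite filter_uniq ?iota_uniq.
  have sn0 : s != [::] by apply: contraTneq sn => ->.
  have [i [j [si sj nij Vij Vji]]] := valuation_ring_tie valV Us sn0 nzf sum0.
  wlog lt_ij : i j si sj nij Vij Vji / (i < j)%N.
    move=> IH; have [/IH|/IH|eij] := ltngtP i j; [exact | apply => // | ].
      by rewrite eq_sym.
    by rewrite eij eqxx in nij.
  have le_jn : (j <= n)%N by move: sj; rewrite mem_filter mem_iota => /andP[].
  have nzc m : m \in s -> c m != 0.
    by move=> /nzf; apply: contra_neq; rewrite /f => ->; rewrite scale0r mul0r.
  have ci0 := nzc i si; have cj0 := nzc j sj.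
  exists (j - i)%N, (ord p (c i) - ord p (c j)); set k := _ - _.
  have Dxj : x ^+ j = x ^+ (j - i) * x ^+ i by rewrite -exprD subnK // ltnW.
  have Vu (e : int) : ((c i / c j / pi ^ k) ^ e)%:A \in V.
    rewrite VE ordZ ?ordM ?ordV ?ordZ ?ppi ?mulf_neq0 ?invr_neq0 ?expfz_neq0 //.
    by rewrite mul1r subrr mul0r.
  have xi0 m : x ^+ m != 0 by rewrite expf_neq0.
  split; [by rewrite subn_gt0
         | by rewrite (leq_trans (leq_subr _ _)) ?(leq_trans le_jn) | |].
    have -> : x ^+ (j - i) / pi%:A ^ k = f j / f i * ((c i / c j / pi ^ k) ^ 1)%:A.
      rewrite /f expr1z !algM -!algV -algZ Dxj; field.
      by rewrite !inj0 // !xi0 expfz_neq0 ?inj0.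
    by rewrite rpredM ?Vu.
  have -> : pi%:A ^ k / x ^+ (j - i) = f i / f j * ((c i / c j / pi ^ k) ^ (-1))%:A.
    rewrite exprN1 -algV !algM -!algV -algZ /f Dxj; field.
    by rewrite !inj0 // !xi0 expfz_neq0 ?inj0.
  by rewrite rpredM ?Vu.
have P0 := inj0 _ pi0; have PZ0 (k : int) : pi%:A ^ k != 0 :> L by rewrite expfz_neq0.
pose N := (\dim {:L})`!; have N_gt0 : (0 < N)%N by rewrite fact_gt0.
pose unit_at (x : L) (k : int) := x ^+ N / pi%:A ^ k \in V /\ pi%:A ^ k / x ^+ N \in V.
have /choice[w wP] : forall x : L, exists k : int,
    (x = 0 -> k = 0) /\ (x != 0 -> unit_at x k).
  move=> x; have [->|x0] := eqVneq x 0; first by exists 0.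
  have [n [k [n_gt0 le_nd Vk Vk']]] := tie x x0.
  have /dvdnP[m Dm] : (n %| N)%N by rewrite dvdn_fact ?n_gt0.
  exists (k * m); split=> [/eqP|_]; first by rewrite (negPf x0).
  rewrite /unit_at Dm mulnC exprM -exprz_exp -exprnP -!exprVn -!exprMn.
  by rewrite !rpredX ?exprVn.
have w0 : w 0 = 0 by have [/(_ erefl)] := wP 0.
have VpiZ (k : int) : (pi%:A ^ k \in V) = (0 <= k).
  by rewrite algZ VE ordZ // ppi mul1r.
(* w x is the greatest k such that x^N / pi^k lies in V *)
have le_w (x : L) (k : int) : x != 0 -> x ^+ N / pi%:A ^ k \in V -> k <= w x.
  move=> x0 Vk; have [_ /(_ x0)[_ Vw]] := wP x.
  have := rpredM Vw Vk; rewrite mulrA divfK ?expf_neq0 // invr_expz -expfzDr //.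
  by rewrite VpiZ subr_ge0.
have w_le (x : L) (k : int) : x != 0 -> k <= w x -> x ^+ N / pi%:A ^ k \in V.
  move=> x0; rewrite -subr_ge0 -VpiZ => Vk; have [_ /(_ x0)[Vw _]] := wP x.
  have := rpredM Vw Vk; rewrite expfzDr // mulrA divfK ?PZ0 //.
  by rewrite invr_expz.
have wE (x : L) (k : int) : x != 0 -> unit_at x k -> w x = k.
  move=> x0 [Vk Vk']; apply/le_anti; rewrite le_w // andbT.
  have [_ /(_ x0)[Vw _]] := wP x; have := rpredM Vk' Vw.
  by rewrite mulrA divfK ?expf_neq0 // invr_expz -expfzDr // VpiZ subr_ge0.
have wM x y : x != 0 -> y != 0 -> w (x * y) = w x + w y.
  move=> x0 y0; have [_ /(_ x0)[Vx Vx']] := wP x; have [_ /(_ y0)[Vy Vy']] := wP y.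
  apply: wE; first exact: mulf_neq0.
  split; rewrite expfzDr // exprMn invfM mulrACA; exact: rpredM.
have wK x : w x%:A = ord p x *+ N.
  have [->|x0] := eqVneq x 0; first by rewrite scale0r Defs.ord0 mul0rn.
  apply: wE; first exact: inj0.
  rewrite /unit_at algX algZ !algV -!algM !VE.
  rewrite !ordM ?ordV ?ordZ ?ordX ?ppi ?invr_neq0 ?expf_neq0 ?expfz_neq0 //.
  by rewrite mul1r !subrr.
have wD x y : x != 0 -> y != 0 -> x + y != 0 -> w x <= w y -> w x <= w (x + y).
  move=> x0 y0 xy0 le_xy; apply: le_w => //.
  (* y^N / x^N lies in V, which is integrally closed *)
  have Vyx : y / x \in V.
    apply: (valuation_ring_integral valV (n := N)
      (a := fun i => if i == 0%N then (y / x) ^+ N else 0)).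
      move=> i _; case: ifP => _; last exact: rpred0.
      have [_ /(_ x0)[_ Vx']] := wP x; have := rpredM (w_le _ _ y0 le_xy) Vx'.
      by rewrite mulrA divfK // exprMn exprVn.
    rewrite -(prednK N_gt0) big_ord_recl /= expr0 mulr1 big1 ?addr0 // => i _.
    by rewrite mul0r.
  have -> : x + y = x * (1 + y / x) by rewrite mulrDr mulr1 mulrCA divff ?mulr1.
  rewrite exprMn mulrAC rpredM ?rpredX ?rpredD ?rpred1 //.
  exact: w_le.
have [x y x0 y0 xy0||B [g [g_gt0 Dw]]] := normalize_valuation w0 wM.
- have [le_xy|/ltW le_yx] := leP (w x) (w y); first exact: wD.
  by rewrite addrC wD // addrC.
- by exists pi%:A; rewrite wK ppi -mulr_natr natz; lia.
have BN x : ord B x%:A * g%:Z = ord p x * N%:Z.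
  by rewrite -!natz !mulr_natr -wK Dw.
have g0 : g%:Z != 0 by rewrite -lt0n.
have Dx x : ord B x%:A = ord p x * ord B pi%:A.
  by apply: (mulIf g0); rewrite BN -mulrA BN ppi mul1r.
have Bpi_gt0 : 0 < ord B pi%:A.
  by rewrite -(pmulr_lgt0 (x := g%:Z)) // BN ppi mul1r.
exists B, `|ord B pi%:A|%N; split=> [|x]; first by lia.
by rewrite Dx -mulr_natr natz gez0_abs // ltW.
Qed.
End Extension.

(** The two normalized valuations are proportional on [K], hence equal; primes
    being records with proofs, equality of the valuations suffices by proof
    irrelevance. *)
Lemma lies_above_inj (K : fieldType) (L : splittingFieldType K) (B : prime_of L)
    (p q : prime_of K) : lies_above B p -> lies_above B q -> p = q.
Proof.
move=> [e [e_gt0 De]] [f [f_gt0 Df]].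
have Dpq x : ord p x * e%:Z = ord q x * f%:Z.
  by rewrite -!natz !mulr_natr -De Df.
have [x px] := ord_normalized p; have [y qy] := ord_normalized q.
have eqef : e = f.
  have := Dpq x; have := Dpq y; rewrite px qy !mul1r => Dy Dx.
  apply/eqP; rewrite eqn_dvd; apply/andP; split.
    by apply/dvdnP; exists `|ord p y|%N; move: Dy; nia.
  by apply/dvdnP; exists `|ord q x|%N; move: Dx; nia.
have ordpq : ord p = ord q.
  by apply/funext => z; apply: (mulIf (_ : e%:Z != 0)); rewrite -?lt0n // Dpq eqef.
case: p q ordpq {De Df Dpq x px y qy eqef} => [v v0 vM vD v1] [w w0 wM wD w1] /= vw.
by subst w; congr PrimeOf; apply: Prop_irrelevance.
Qed.

(** * Weierstrass equations and 2-division roots *)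

Lemma natr_neq0 (K : fieldExtType rat) n : n.+1%:R != 0 :> K.
Proof. by rewrite -(rmorph_nat (in_alg K)) fmorph_eq0 pnatr_eq0. Qed.

Section Weierstrass.
Variables (K : fieldType) (E : weierstrass K).

Lemma b8E : 4 * b8 E = b2 E * b6 E - b4 E ^+ 2.
Proof. by rewrite /b8 /b2 /b4 /b6; ring. Qed.

Variables (u r s t : K).
Hypothesis u0 : u != 0.
Let E' := change_coord u r s t E.

Lemma b2_change : b2 E' = (b2 E + 12 * r) / u ^+ 2.
Proof. by rewrite /b2 /=; field. Qed.

Lemma b4_change : b4 E' = (b4 E + r * b2 E + 6 * r ^+ 2) / u ^+ 4.
Proof. by rewrite /b4 /b2 /=; field. Qed.

Lemma b6_change :
  b6 E' = (b6 E + 2 * r * b4 E + r ^+ 2 * b2 E + 4 * r ^+ 3) / u ^+ 6.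
Proof. by rewrite /b6 /b4 /b2 /=; field. Qed.

Lemma disc_change : disc E' = disc E / u ^+ 12.
Proof. by rewrite /disc b2_change b4_change b6_change /b8 /b2 /b4 /b6 /=; field. Qed.

End Weierstrass.

Section Roots.
Variables (K : fieldExtType rat) (L : splittingFieldType K).
Implicit Types (E : weierstrass K) (e x : L).

Let nz n : n.+1%:R != 0 :> L.
Proof. by rewrite -(rmorph_nat (in_alg L)) fmorph_eq0 natr_neq0. Qed.

(** Vieta's formulas. *)
Lemma two_division_rootsP E (e1 e2 e3 : L) : two_division_roots E e1 e2 e3 <->
  [/\ (b2 E)%:A = - 4 * (e1 + e2 + e3),
      (b4 E)%:A = 2 * (e1 * e2 + e1 * e3 + e2 * e3)
    & (b6 E)%:A = - 4 * (e1 * e2 * e3)].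
Proof.
have Dr : 4 *: (('X - e1%:P) * ('X - e2%:P) * ('X - e3%:P)) =
    4 *: 'X^3 + (- 4 * (e1 + e2 + e3)) *: 'X^2
    + (4 * (e1 * e2 + e1 * e3 + e2 * e3)) *: 'X + (- 4 * (e1 * e2 * e3))%:P.
  by rewrite -!mul_polyC; ring.
have Dl : map_poly (in_alg L) (two_division_poly E) =
    4 *: 'X^3 + (b2 E)%:A *: 'X^2 + (2 * (b4 E)%:A) *: 'X + (b6 E)%:A%:P.
  rewrite /two_division_poly; move: (b2 E) (b4 E) (b6 E) => b b' b''.
  rewrite !rmorphD /= !map_polyZ /= !map_polyXn map_polyX map_polyC /=.
  by rewrite -!in_algE !rmorphM !rmorph_nat.
rewrite /two_division_roots Dl Dr; split=> [Dp|[-> -> ->]]; last first.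
  by congr (_ + _ *: 'X + _); ring.
have Dc i := congr1 (fun p : {poly L} => p`_i) Dp.
split.
- by have := Dc 2%N; rewrite !coefE /= !mulr0 !mulr1 !addr0 !add0r.
- have := Dc 1%N; rewrite !coefE /= !mulr0 !mulr1 !addr0 !add0r => D4.
  by apply: (mulfI (nz 1)); rewrite D4; ring.
- by have := Dc 0%N; rewrite !coefE /= !mulr0 !add0r.
Qed.

Lemma disc_roots E (e1 e2 e3 : L) : two_division_roots E e1 e2 e3 ->
  (disc E)%:A = 16 * ((e1 - e2) * (e1 - e3) * (e2 - e3)) ^+ 2.
Proof.
move=> /two_division_rootsP[D2 D4 D6]; apply: (mulfI (nz 3)).
have -> : 4 * (disc E)%:A = (- b2 E ^+ 2 * (b2 E * b6 E - b4 E ^+ 2)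
    - 32 * b4 E ^+ 3 - 108 * b6 E ^+ 2 + 36 * (b2 E * b4 E * b6 E))%:A :> L.
  by rewrite -b8E -(rmorph_nat (in_alg L)) -!in_algE -rmorphM; congr (in_alg L _);
    rewrite /disc; ring.
move: (b2 E) (b4 E) (b6 E) D2 D4 D6 => b b' b'' D2 D4 D6.
transitivity (- b%:A ^+ 2 * (b%:A * b''%:A - b'%:A ^+ 2)
    - 32 * b'%:A ^+ 3 - 108 * b''%:A ^+ 2 + 36 * (b%:A * b'%:A * b''%:A) : L).
  by rewrite -!in_algE; ring.
by rewrite D2 D4 D6; ring.
Qed.

Lemma roots_distinct E (e1 e2 e3 : L) : two_division_roots E e1 e2 e3 -> disc E != 0 ->
  [/\ e1 != e2, e1 != e3 & e2 != e3].
Proof.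
move=> roots disc0; have : (disc E)%:A != 0 :> L by rewrite -in_algE fmorph_eq0.
rewrite (disc_roots roots) mulf_eq0 expf_eq0 /= !mulf_eq0 !subr_eq0 !negb_or -!andbA.
by case/and4P.
Qed.

Lemma two_division_roots_change E u r s t (e1 e2 e3 : L) : u != 0 ->
    two_division_roots E e1 e2 e3 ->
  two_division_roots (change_coord u r s t E)
    ((e1 - r%:A) / u%:A ^+ 2) ((e2 - r%:A) / u%:A ^+ 2) ((e3 - r%:A) / u%:A ^+ 2).
Proof.
move=> u0 /two_division_rootsP[D2 D4 D6]; apply/two_division_rootsP.
rewrite b2_change // b4_change // b6_change //.
move: (b2 E) (b4 E) (b6 E) D2 D4 D6 => b b' b'' D2 D4 D6.
have u0L : u%:A != 0 :> L by rewrite -in_algE fmorph_eq0.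
have algD (a c : K) n : ((a + c) / u ^+ n)%:A = (a%:A + c%:A) / u%:A ^+ n :> L.
  by rewrite -!in_algE rmorphM fmorphV rmorphXn rmorphD.
split; rewrite algD.
- transitivity ((b%:A + 12 * r%:A) / u%:A ^+ 2 : L).
    by congr (_ / _); rewrite -!in_algE; ring.
  by rewrite D2; field.
- transitivity ((b'%:A + r%:A * b%:A + 6 * r%:A ^+ 2) / u%:A ^+ 4 : L).
    by congr (_ / _); rewrite -!in_algE; ring.
  by rewrite D2 D4; field.
- transitivity ((b''%:A + 2 * r%:A * b'%:A + r%:A ^+ 2 * b%:A + 4 * r%:A ^+ 3)
      / u%:A ^+ 6 : L).
    by congr (_ / _); rewrite -!in_algE; ring.
  by rewrite D2 D4 D6; field.
Qed.

Lemma two_division_roots_horner E (e1 e2 e3 : L) x : two_division_roots E e1 e2 e3 ->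
  root (map_poly (in_alg L) (two_division_poly E)) x = (x \in [:: e1; e2; e3]).
Proof.
move=> ->; rewrite rootZ ?nz // !rootM !root_XsubC !inE orbA.
by rewrite -!orbA.
Qed.

(** The roots are integral over the ring of [B], since [2] is invertible there;
    their differences are integral and have a product of valuation 0. *)
Lemma lambda_unit (B : prime_of L) E (e1 e2 e3 : L) :
    two_division_roots E e1 e2 e3 -> ord B 2 = 0 ->
    [/\ 0 <= ord B (b2 E)%:A, 0 <= ord B (b4 E)%:A & 0 <= ord B (b6 E)%:A] ->
    disc E != 0 -> ord B (disc E)%:A = 0 ->
  ord B ((e1 - e3) / (e1 - e2)) = 0.
Proof.
move=> roots B2 [B2_ge0 B4_ge0 B6_ge0] disc0 Bdisc.
have /two_division_rootsP[D2 D4 D6] := roots.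
have V2 : 2^-1 \in ord_ring B by rewrite inE ordV B2.
have Ve e : e \in [:: e1; e2; e3] -> e \in ord_ring B.
  (* a lists the coefficients in e^3 = a_0 + a_1 e + a_2 e^2 *)
  move=> De; pose a i : L := nth 0
    [:: - ((b6 E)%:A * 2^-1 ^+ 2); - ((b4 E)%:A * 2^-1); - ((b2 E)%:A * 2^-1 ^+ 2)] i.
  apply: (valuation_ring_integral (ord_valuation_ring B) (n := 3) (a := a)).
    by case=> [|[|[|i]]] // _; rewrite rpredN rpredM ?rpredX.
  rewrite !big_ord_recr big_ord0 /= /a /= D2 D4 D6.
  by move: De; rewrite !inE => /or3P[]/eqP->; field; exact: nz 1.
have [V1 V3 V5] : [/\ e1 \in ord_ring B, e2 \in ord_ring B & e3 \in ord_ring B].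
  by split; apply: Ve; rewrite !inE eqxx ?orbT.
have := disc_roots roots => Ddisc.
have [] := roots_distinct roots disc0; rewrite -[e1 == e2]subr_eq0.
rewrite -[e1 == e3]subr_eq0 -[e2 == e3]subr_eq0 => n12 n13 n23.
have B16 : ord B 16 = 0 by rewrite (_ : 16 = 2 ^+ 4) ?ordX ?B2 ?mul0rn //; ring.
rewrite Ddisc ordM ?expf_neq0 ?mulf_neq0 // B16 ordX !ordM ?mulf_neq0 // in Bdisc.
have : 0 <= ord B (e1 - e2) by rewrite -ord_ringE rpredB.
have : 0 <= ord B (e1 - e3) by rewrite -ord_ringE rpredB.
have : 0 <= ord B (e2 - e3) by rewrite -ord_ringE rpredB.
move: Bdisc; rewrite ordM ?invr_eq0 // ordV; lia.
Qed.

End Roots.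

Lemma ord_primes_ext (K : fieldType) (S : set (prime_of K)) (n : nat) p :
  ~ primes_ext S n p -> ~ S p /\ ord p n%:R = 0.
Proof.
move=> Sp; split=> [?|]; first by apply: Sp; left.
apply/le_anti; rewrite -[0 <= _]ord_ringE rpred_nat andbT leNgt.
by apply/negP => n_gt0; apply: Sp; right.
Qed.

Lemma primes_extS (K : fieldType) (S : set (prime_of K)) (m n : nat) :
  m%:R != 0 :> K -> n%:R != 0 :> K -> (primes_ext S m `<=` primes_ext S (m * n))%classic.
Proof.
move=> m0 n0 p [Sp|pm]; [by left | right; rewrite /= natrM ordM //].
by rewrite ltr_wpDr // -ord_ringE rpred_nat.
Qed.

(** [p] being outside [S^(2)] gives both a model with good reduction and the
    invertibility of [2]. *)
Lemma lambda_S_unit (K : fieldExtType rat) (L : splittingFieldType K)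
    (S : set (prime_of K)) (E : elliptic_curve K) (e1 e2 e3 : L) :
    good_reduction_outside S E -> two_division_roots E e1 e2 e3 ->
  S_units (primes_above L (primes_ext S 2)) ((e1 - e3) / (e1 - e2)).
Proof.
move=> goodE roots; have disc0 := ec_disc E; split.
  have [n12 n13 _] := roots_distinct roots disc0.
  by rewrite mulf_neq0 ?invr_neq0 // subr_eq0.
move=> B SB; have [p [e ram]] := restrict_prime B.
have [|Sp p2] := ord_primes_ext (_ : ~ primes_ext S 2 p).
  by move=> Sp; apply: SB; exists p => //; exists e.
have De x : ord B x%:A = ord p x *+ e by case: ram.
have [u [r [s [t [u0 [p1 p2' p3 p4 p6] pdisc]]]]] := goodE p Sp.
set E' := change_coord u r s t E in p1 p2' p3 p4 p6 pdisc.
have uL0 : u%:A != 0 :> L by rewrite -in_algE fmorph_eq0.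
have disc'0 : disc E' != 0 by rewrite disc_change // mulf_neq0 ?invr_neq0 ?expf_neq0.
have := two_division_roots_change r s t u0 roots; rewrite -/E'.
set e1' := _ / _; set e2' := _ / _; set e3' := _ / _ => roots'.
have -> : (e1 - e3) / (e1 - e2) = (e1' - e3') / (e1' - e2').
  rewrite /e1' /e2' /e3' -!mulrBl -mulf_div divff ?mulr1 ?invr_neq0 ?expf_neq0 //.
  by rewrite !opprB !addrA !subrK.
have integral x : x \in ord_ring p -> 0 <= ord B x%:A.
  by rewrite ord_ringE De => ?; rewrite mulrn_wge0.
apply: (lambda_unit roots') => //.
- by have := De 2%:R; rewrite p2 mul0rn -in_algE rmorph_nat.
- split; apply: integral.
  + by rewrite rpredD ?rpredX // rpredM ?rpred_nat.
  + by rewrite rpredD // rpredM ?rpred_nat.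
  + by rewrite rpredD ?rpredX // rpredM ?rpred_nat.
- by rewrite De pdisc mul0rn.
Qed.

(** * The j-invariant: dependence on lambda, and curves with a given j-invariant *)

Section JLambda.
Variables (K : fieldType) (L : splittingFieldType K).

Lemma j_of_lambda_rmorph (f : {rmorphism L -> L}) (l : L) :
  f (j_of_lambda l) = j_of_lambda (f l).
Proof.
rewrite /j_of_lambda rmorphM fmorph_div (rmorphM f (l ^+ 2)) !rmorphXn rmorph_nat.
by rewrite rmorphD !rmorphB rmorph1 rmorphXn.
Qed.

Lemma j_of_lambdaV (l : L) : l != 0 -> 1 - l != 0 -> j_of_lambda l^-1 = j_of_lambda l.
Proof.
move=> l0 m0; rewrite /j_of_lambda; field; rewrite l0 m0 /=.
by rewrite -opprB oppr_eq0.
Qed.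

Lemma j_of_lambda_V1B (l : L) : l != 0 -> 1 - l != 0 ->
  j_of_lambda (1 - l)^-1 = j_of_lambda l.
Proof.
move=> l0 m0; rewrite /j_of_lambda; field; rewrite l0 m0 /=.
by rewrite addrAC subrr add0r oppr_eq0.
Qed.

End JLambda.

(** With [Du] below, [a4^3] is, up to a unit at [p], [z j], and [a6^2] is
    [z (j - 1728)]; so if [z] has valuation [12 k], then [a4] and [a6] have
    valuation at least [4 k] and [6 k], and dividing them by [v^4] and [v^6], where
    [v] has valuation [k], leaves an integral model. *)
Lemma curve_of_j (K : fieldExtType rat) (S : set (prime_of K)) (j : K) :
    S_integers (primes_ext S 2) j ->
    selmer_im S 6 12 (j ^+ 2 * (j - 1728) ^+ 3) ->
  exists2 E : elliptic_curve K,
    jinv E = j & good_reduction_outside (primes_ext S 6) E.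
Proof.
move=> jS [z [z0 zS] [y y0 Dw]].
have nz n : n.+1%:R != 0 :> K := natr_neq0 K n.
pose u := (3 * y)^-1.
pose W : weierstrass K := Weierstrass 0 0 0 (- 3 * u ^+ 2 * (j * (j - 1728)))
  (- 2 * u ^+ 3 * (j * (j - 1728) ^+ 2)).
have Du : u ^+ 6 * (j ^+ 2 * (j - 1728) ^+ 3) = z / 3 ^+ 6.
  by rewrite Dw /u; field; rewrite y0 !nz.
have discW : disc W = 2 ^+ 12 * z.
  transitivity (2 ^+ 12 * 3 ^+ 6 * (u ^+ 6 * (j ^+ 2 * (j - 1728) ^+ 3))).
    by rewrite /disc /b8 /b6 /b4 /b2 /=; ring.
  by rewrite Du; field; rewrite !nz.
have discW0 : disc W != 0 by rewrite discW mulf_neq0 ?expf_neq0 ?nz.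
exists (EllipticCurve discW0) => [|p Sp].
  rewrite /jinv /=; apply: (mulIf discW0); rewrite divfK //.
  by rewrite /disc /c4 /b8 /b6 /b4 /b2 /=; ring.
have [nSp p6] := ord_primes_ext Sp.
have p23 : ord p 2 = 0 /\ ord p 3 = 0.
  have : ord p 2 + ord p 3 = 0.
    by rewrite -(ordM p (nz 1) (nz 2)) -natrM.
  have : 0 <= ord p 2 by rewrite -ord_ringE rpred_nat.
  have : 0 <= ord p 3 by rewrite -ord_ringE rpred_nat.
  by lia.
have [p2 p3] := p23.
have pj : j \in ord_ring p.
  by apply: jS => p2S; apply: Sp; apply: (@primes_extS _ _ 2 3).
have /dvdzP[k Dk] := zS p nSp.
have [v v0 Dv] : exists2 v, v != 0 & ord p v = k.
  have [x px] := ord_normalized p.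
  have x0 : x != 0 by apply: contra_eq_neq px => ->; rewrite Defs.ord0.
  by exists (x ^ k); rewrite ?expfz_neq0 // ordZ // px mul1r.
have pzv : ord p (z / v ^+ 12) = 0.
  rewrite ordM ?invr_neq0 ?expf_neq0 // ordV ordX Dv Dk -mulr_natr natz.
  by rewrite subrr.
have Vzv : z / v ^+ 12 \in ord_ring p by rewrite ord_ringE pzv.
have V3 : 3^-1 \in ord_ring p by rewrite ord_ringE ordV p3.
have ord_root a n : (0 < n)%N -> a ^+ n \in ord_ring p -> 0 <= ord p a.
  by move=> n_gt0; rewrite ord_ringE ordX pmulrn_lge0.
exists v, 0, 0, 0; split=> //; last first.
  rewrite disc_change //= discW -mulrA ordM ?ordX ?p2 ?pzv ?mul0rn ?expf_neq0 ?nz //.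
  by rewrite mulf_neq0 ?invr_neq0 ?expf_neq0.
split; rewrite /= ?(mul0r, mulr0, addr0, subr0, oppr0, expr0n, mul0rn) /= ?Defs.ord0 //.
- apply: (ord_root _ 3) => //.
  have -> : (- 3 * u ^+ 2 * (j * (j - 1728)) / v ^+ 4) ^+ 3 =
      - (3^-1 ^+ 3 * (z / v ^+ 12) * j).
    transitivity (- 27 * (u ^+ 6 * (j ^+ 2 * (j - 1728) ^+ 3)) * j / v ^+ 12).
      by field.
    by rewrite Du; field; rewrite v0 !nz.
  by rewrite rpredN; exact: rpredM (rpredM (rpredX _ V3) Vzv) pj.
- apply: (ord_root _ 2) => //.
  have -> : (- 2 * u ^+ 3 * (j * (j - 1728) ^+ 2) / v ^+ 6) ^+ 2 =
      4 * 3^-1 ^+ 6 * (z / v ^+ 12) * (j - 1728).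
    transitivity (4 * (u ^+ 6 * (j ^+ 2 * (j - 1728) ^+ 3)) * (j - 1728) / v ^+ 12).
      by field.
    by rewrite Du; field; rewrite v0 !nz.
  apply: rpredM; last by rewrite rpredB ?rpred_nat.
  exact: rpredM (rpredM (rpred_nat _ _) (rpredX _ V3)) Vzv.
Qed.

(** * The Galois action on the roots *)

(** If one generator were trivial, the other would generate a group of order 6. *)
Lemma S3_generators (gT : finGroupType) (G : {group gT}) (x y : gT) :
    G :=: <<[set x; y]>>%g -> (G \isog [set: 'S_3])%g ->
    (x ^+ 3 = 1)%g -> (y ^+ 2 = 1)%g ->
  #[x]%g = 3%N /\ #[y]%g = 2%N.
Proof.
move=> defG isoG x3 y2.
have oG : #|G| = 6%N by rewrite (card_isog isoG) cardsT card_Sn.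
split; apply: nt_prime_order => //; apply/eqP => z1.
  have : (G \subset <[y]>)%g.
    by rewrite defG gen_subG finset.subUset !finset.sub1set z1 group1 cycle_id.
  move/subset_leq_card; rewrite oG => /leq_trans/(_ (dvdn_leq (isT : 0 < 2)%N _)).
  by rewrite -/(order y) order_dvdn y2 eqxx => /(_ isT).
have : (G \subset <[x]>)%g.
  by rewrite defG gen_subG finset.subUset !finset.sub1set z1 group1 cycle_id.
move/subset_leq_card; rewrite oG => /leq_trans/(_ (dvdn_leq (isT : 0 < 3)%N _)).
by rewrite -/(order x) order_dvdn x3 eqxx => /(_ isT).
Qed.

Section Norms.
Variables (K : fieldType) (L : splittingFieldType K) (g : gal_of {:L}).

Lemma galNorm_cycle (x : L) :
  galNorm [aspace of fixedField <[g]>%g] {:L} x = \prod_(i < #[g]%g) (g ^+ i)%g x.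
Proof.
rewrite /galNorm /= gal_generated genGid.
rewrite (eq_bigl _ _ (cycle_traject g)) -big_uniq /=; last first.
  by apply/card_uniqP; rewrite size_traject -(eq_card (cycle_traject g)).
have -> : traject (mulg g) 1%g #[g]%g = [seq (g ^+ i)%g | i <- index_iota 0 #[g]%g].
  apply: (@eq_from_nth _ 1%g) => [|i]; first by rewrite size_traject size_map size_iota subn0.
  rewrite size_traject => lt_i; rewrite nth_traject // (nth_map 0%N) ?size_iota ?subn0 //.
  rewrite nth_iota ?subn0 // add0n; elim: i {lt_i} => // i IHi.
  by rewrite iterS IHi expgS.
by rewrite big_map big_mkord.
Qed.

Lemma galNorm_cycle2 (x : L) : #[g]%g = 2%N ->
  galNorm [aspace of fixedField <[g]>%g] {:L} x = x * g x.
Proof.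
by move=> og; rewrite galNorm_cycle og !big_ord_recl big_ord0 /= gal_id expg1 mulr1.
Qed.

Lemma galNorm_cycle3 (x : L) : #[g]%g = 3%N ->
  galNorm [aspace of fixedField <[g]>%g] {:L} x = x * g x * g (g x).
Proof.
move=> og; rewrite galNorm_cycle og !big_ord_recl big_ord0 /= gal_id expg1 mulr1 mulrA.
by rewrite expgS expg1 galM ?memvf.
Qed.

End Norms.

(** The combinatorics of a 3-cycle [s] and a transposition [t] on three points,
    relative to a symmetric relation [P]: [a] is the fixed point of [t].  The proof
    enumerates the values of [s] and [t]. *)
Lemma S3_labelling (T : Type) (P : T -> T -> T -> Prop) (s t : T -> T) (e1 e2 e3 : T) :
    (forall x y z, P x y z -> P y x z) -> (forall x y z, P x y z -> P y z x) ->
    injective s -> injective t ->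
    let is_e x := [\/ x = e1, x = e2 | x = e3] in
    (forall x, is_e x -> is_e (s x)) -> (forall x, is_e x -> is_e (t x)) ->
    [/\ e1 <> e2, e1 <> e3 & e2 <> e3] ->
    (forall x, s (s (s x)) = x) -> (forall x, t (t x) = x) ->
    ~ (forall x, is_e x -> s x = x) -> ~ (forall x, is_e x -> t x = x) ->
    P e1 e2 e3 ->
  exists a b c, P a b c /\ [/\ s a = b, s b = c & s c = a] /\
    [/\ t a = a, t b = c & t c = b].
Proof.
move=> P12 P123 inj_s inj_t is_e s_e t_e [n12 n13 n23] s3 t2 s1 t1 P0.
have h1 : is_e e1 by constructor 1.
have h2 : is_e e2 by constructor 2.
have h3 : is_e e3 by constructor 3.
have t1' : t e1 = e1 -> t e2 = e2 -> t e3 = e3 -> False.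
  by move=> E1 E2 E3; apply: t1 => x [] ->.
have s1' : s e1 = e1 -> s e2 = e2 -> s e3 = e3 -> False.
  by move=> E1 E2 E3; apply: s1 => x [] ->.
have [I12 I13 I23] : [/\ s e1 <> s e2, s e1 <> s e3 & s e2 <> s e3].
  by split=> /inj_s.
have [J12 J13 J23] : [/\ t e1 <> t e2, t e1 <> t e3 & t e2 <> t e3].
  by split=> /inj_t.
have [P1 P2 P3 P4 P5] : [/\ P e1 e3 e2, P e2 e1 e3, P e2 e3 e1, P e3 e1 e2 & P e3 e2 e1].
  by split; auto.
have S1 := s3 e1; have S2 := s3 e2; have T1 := t2 e1; have T2 := t2 e2; have T3 := t2 e3.
(* first the values of s, of which only the two 3-cycles survive *)
case: (s_e _ h1) => s1E; case: (s_e _ h2) => s2E; case: (s_e _ h3) => s3E; try congruence;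
  try (exfalso; move: S1 S2; rewrite !(s1E, s2E, s3E); congruence);
  try (by case: s1').
all: case: (t_e _ h1) => t1E; case: (t_e _ h2) => t2E; case: (t_e _ h3) => t3E; try congruence;
  try (exfalso; move: T1 T2 T3; rewrite !(t1E, t2E, t3E); congruence);
  try (by case: t1').
all: first [by exists e1, e2, e3 | by exists e1, e3, e2 | by exists e2, e1, e3
  | by exists e2, e3, e1 | by exists e3, e1, e2 | by exists e3, e2, e1].
Qed.

(** The Galois group permutes the roots because they are the zeros of a polynomial
    over [K], and does so faithfully because they generate [L]. *)
Lemma good_lambda (K : fieldExtType rat) (L : splittingFieldType K)
    (sigma tau : gal_of {:L}) (E : weierstrass K) :
    #[sigma]%g = 3%N -> #[tau]%g = 2%N ->
    is_two_division_field L E -> disc E != 0 ->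
  exists a b c : L, [/\ two_division_roots E a b c,
    [/\ sigma a = b, sigma b = c & sigma c = a]
    & [/\ tau a = a, tau b = c & tau c = b]].
Proof.
move=> o_sigma o_tau [e1 [e2 [e3 [roots genL]]]] disc0.
have [n12 n13 n23] := roots_distinct roots disc0.
have gal_root (g : gal_of {:L}) x :
    [\/ x = e1, x = e2 | x = e3] -> [\/ g x = e1, g x = e2 | g x = e3].
  have rootE y : root (map_poly (in_alg L) (two_division_poly E)) y ->
      [\/ y = e1, y = e2 | y = e3].
    rewrite (two_division_roots_horner _ roots) !inE => /or3P[]/eqP->;
      by [constructor 1 | constructor 2 | constructor 3].
  move=> ex; apply: rootE.
  have -> : map_poly (in_alg L) (two_division_poly E) =
            map_poly g (map_poly (in_alg L) (two_division_poly E)).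
    by rewrite -map_poly_comp; apply: eq_map_poly => y /=; rewrite rmorph_alg.
  rewrite fmorph_root (two_division_roots_horner _ roots) !inE.
  by case: ex => ->; rewrite eqxx ?orbT.
have faithful (g : gal_of {:L}) : (1 < #[g]%g)%N ->
    ~ (forall x, [\/ x = e1, x = e2 | x = e3] -> g x = x).
  move=> g_gt1 fix_e; suff g1 : g = 1%g by rewrite g1 order1 in g_gt1.
  have : (<<1 & [:: e1; e2; e3]>> <= fixedField [set g])%VS.
    apply/Fadjoin_seqP; split; first exact: sub1v.
    move=> x; rewrite !inE => ex; apply/fixedFieldP; first exact: memvf.
    move=> h; rewrite finset.in_set1 => /eqP->; apply: fix_e.
    by case/or3P: ex => /eqP->; by [constructor 1 | constructor 2 | constructor 3].
  rewrite genL => /subvP fixL; apply/eqP/gal_eqP => x xL; rewrite gal_id.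
  by have /mem_fixedFieldP[_ ->] := fixL x xL; rewrite ?finset.set11.
have sigma3 x : sigma (sigma (sigma x)) = x.
  have := gal_id {:L} x; rewrite -(expg_order sigma) o_sigma !expgS expg0 mulg1.
  by rewrite !galM ?memvf.
have tau2 x : tau (tau x) = x.
  have := gal_id {:L} x; rewrite -(expg_order tau) o_tau !expgS expg0 mulg1.
  by rewrite galM ?memvf.
have [|||||||||a [b [c [rootsP [sP tP]]]]] := @S3_labelling _ (two_division_roots E)
  sigma tau e1 e2 e3 _ _ _ _ _ _ _ sigma3 tau2 _ _ roots.
- by move=> x y z; rewrite /two_division_roots => ->; congr (_ *: (_ * _)); rewrite mulrC.
- move=> x y z; rewrite /two_division_roots => ->; congr (_ *: _).
  by rewrite -mulrA mulrC.
- exact: fmorph_inj.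
- exact: fmorph_inj.
- exact: gal_root.
- exact: gal_root.
- by split; apply/eqP.
- by apply: faithful; rewrite o_sigma.
- by apply: faithful; rewrite o_tau.
by exists a, b, c.
Qed.


Theorem theorem4p3 (K : fieldExtType rat) (S : set (prime_of K))
    (finS : finite_set S) (L : splittingFieldType K)
    (galLK : galois 1%AS {:L}%AS)
    (unramLK : unramified_outside L (primes_ext S 2))
    (sigma tau : gal_of {:L}%AS)
    (genLK : ('Gal({:L} / 1) = <<[set sigma; tau]>>)%g)
    (S3LK : ('Gal({:L} / 1) \isog [set: 'S_3])%g)
    (sigma3 : (sigma ^+ 3 = 1)%g) (tau2 : (tau ^+ 2 = 1)%g) :
  let SL := primes_above L (primes_ext S 2) in
  (forall E : elliptic_curve K,
     good_reduction_outside S E ->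
     jinv E != 0 -> jinv E != 1728 ->
     is_two_division_field L E ->
     (lambda_values L E `<=` S_units SL)%classic
     /\ exists2 l, lambda_values L E l & lambda_conditions S sigma tau l)
  /\
  (forall l : L,
     S_units SL l -> S_units SL (1 - l) ->
     j_of_lambda l != 0 -> j_of_lambda l != 1728 ->
     lambda_conditions S sigma tau l ->
     exists j : K,
       [/\ j%:A = j_of_lambda l,
           S_integers (primes_ext S 2) j
         & selmer_im S 6 12 (j ^+ 2 * (j - 1728) ^+ 3) ->
           exists2 E : elliptic_curve K,
             jinv E = j & good_reduction_outside (primes_ext S 6) E]).
Proof.
move=> SL; have [o_sigma o_tau] := S3_generators genLK S3LK sigma3 tau2.
split=> [E goodE _ _ divL | l Ul Um _ _ [[_ normT] _ sl]].
  have unitE l : lambda_values L E l -> S_units SL l.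
    by move=> [e1 [e2 [e3 [roots ->]]]]; exact: lambda_S_unit goodE roots.
  split=> //; have disc0 := ec_disc E.
  have [a [b [c [roots [sa sb sc] [ta tb tc]]]]] := good_lambda o_sigma o_tau divL disc0.
  have [nab nac nbc] := roots_distinct roots disc0.
  pose l := (a - c) / (a - b); have lE : lambda_values L E l by exists a, b, c.
  have Ul := unitE l lE.
  have ab0 : a - b != 0 by rewrite subr_eq0.
  have ac0 : a - c != 0 by rewrite subr_eq0.
  have bc0 : b - c != 0 by rewrite subr_eq0.
  have slE : sigma l = (b - a) / (b - c) by rewrite /l fmorph_div !rmorphB /= sa sb sc.
  exists l => //; split.
  - split=> //; rewrite galNorm_cycle2 // /l fmorph_div !rmorphB /= ta tb tc.
    by field; rewrite ab0 ac0.
  - split.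
      split; first by rewrite oppr_eq0; case: Ul.
      by move=> B SB; rewrite ordN; case: Ul => _; apply.
    rewrite galNorm_cycle3 // !rmorphN /= slE fmorph_div !rmorphB /= sa sb sc /l.
    by field; rewrite ab0 bc0 -opprB oppr_eq0 ac0.
  - have D1 : 1 - l = (c - b) / (a - b) by rewrite /l; field.
    by rewrite slE D1 invf_div -[c - b]opprB invrN mulrN -mulNr opprB.
have [l0 Bl] := Ul; have [m0 Bm] := Um.
have tl : tau l = l^-1.
  by apply: (mulfI l0); rewrite divff // -[RHS]normT galNorm_cycle2.
have jfix (g : gal_of {:L}) : g \in 'Gal({:L} / 1)%g -> g (j_of_lambda l) = j_of_lambda l.
  have jF : j_of_lambda l \in fixedField [set sigma; tau].
    apply/fixedFieldP => [|h]; first exact: memvf.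
    rewrite finset.in_set2 => /orP[]/eqP->; rewrite j_of_lambda_rmorph /=.
      by rewrite sl j_of_lambda_V1B.
    by rewrite tl j_of_lambdaV.
  rewrite genLK -gal_generated => gG.
  by rewrite (fixed_gal _ gG) // subvf.
have : j_of_lambda l \in 1%VS.
  have /galois_fixedField /= <- := galLK.
  by apply/fixedFieldP => //; exact: memvf.
case/vlineP=> j Dj; exists j; rewrite Dj.
have jS : S_integers (primes_ext S 2) j.
  move=> p Sp; have [B [e ram]] := extend_prime L p.
  have SB : ~ SL B.
    move=> [q Sq Bq]; apply: Sp; rewrite (_ : p = q) //.
    by apply: lies_above_inj Bq; exists e.
  have : j%:A \in ord_ring B.
    have Vl : l \in ord_ring B by rewrite ord_ringE Bl.
    have Vl' : l^-1 \in ord_ring B by rewrite ord_ringE ordV Bl.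
    have Vm' : (1 - l)^-1 \in ord_ring B by rewrite ord_ringE ordV Bm.
    rewrite -Dj /j_of_lambda invfM -!exprVn.
    apply: rpredM; first by rewrite rpredX ?rpred_nat.
    apply: rpredM; last by rewrite rpredM ?rpredX.
    by rewrite rpredX // rpredD ?rpred1 // rpredB ?rpredX.
  by case: ram => e_gt0 De; rewrite ord_ringE De pmulrn_lge0.
by split=> //; apply: curve_of_j.
Qed.
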